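(* Let $(B,+,\circ)$ be a finite skew brace. If either $(B,+)$ or $(B,\circ)$ is cyclic, then $B$ is supersoluble.
   Context: A skew brace is a triple $(B,+,\circ)$ with $(B,+)$, $(B,\circ)$ (not necessarily abelian) groups such that $a\circ(b+c)=a\circ b-a+a\circ c$ for all $a,b,c\in B$. The identities of the two groups coincide and are denoted by $0$. For $a\in B$ put $\lambda_a(b)=-a+a\circ b$; then $\lambda:a\mapsto\lambda_a$ is a homomorphism $(B,\circ)\to\operatorname{Aut}(B,+)$. An ideal is a subgroup of $(B,+)$ that is normal in $(B,+)$, invariant under all $\lambda_b$, and normal in $(B,\circ)$; one can form the quotient skew brace $B/I$. The socle is the ideal $\operatorname{Soc}(B)=\operatorname{Ker}(\lambda)\cap Z(B,+)$. $B$ is supersoluble if it has a finite series of ideals $\{0\}=B_0\leq B_1\leq\dots\leq B_n=B$ such that for each $0\leq i<n$ either $B_{i+1}/B_i\leq\operatorname{Soc}(B/B_i)$ and $B_{i+1}/B_i$ is infinite cyclic, or $B_{i+1}/B_i$ has prime order (so for finite $B$ all factors have prime order). *)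

(* Defs.v *)
From HB Require Import structures.
From mathcomp Require Import all_boot all_fingroup all_solvable.
From mathcomp Require Import generic_quotient.
From mathcomp Require Import boolp classical_sets cardinality.

Set Implicit Arguments.
Unset Strict Implicit.
Unset Printing Implicit Defensive.

Declare Scope brace_scope.
Delimit Scope brace_scope with brace.
Local Open Scope classical_set_scope.
Local Open Scope brace_scope.

Reserved Notation "x ** y" (at level 40, left associativity).

HB.mixin Record Choice_isSkewBrace B of Choice B := {
  badd : B -> B -> B;
  bzero : B;
  bopp : B -> B;
  circ : B -> B -> B;
  bone : B;
  binv : B -> B;
  baddA : associative badd;
  badd0l : left_id bzero badd;
  badd0r : right_id bzero badd;
  baddNl : left_inverse bzero bopp badd;
  baddNr : right_inverse bzero bopp badd;
  circA : associative circ;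
  circ1l : left_id bone circ;
  circ1r : right_id bone circ;
  circVl : left_inverse bone binv circ;
  circVr : right_inverse bone binv circ;
  circDr : forall a b c,
    circ a (badd b c) = badd (badd (circ a b) (bopp a)) (circ a c)
}.

#[short(type="skewBraceType")]
HB.structure Definition SkewBrace := {B of Choice_isSkewBrace B & Choice B}.

#[short(type="finSkewBraceType")]
HB.structure Definition FinSkewBrace := {B of SkewBrace B & Finite B}.

Bind Scope brace_scope with SkewBrace.sort.
Bind Scope brace_scope with FinSkewBrace.sort.

Notation "0" := (@bzero _) : brace_scope.
Notation "x + y" := (badd x y) : brace_scope.
Notation "- x" := (bopp x) : brace_scope.
Notation "x - y" := (badd x (bopp y)) : brace_scope.
Notation "x ** y" := (circ x y) : brace_scope.

(* Aliases of the carrier bearing the groups of + and of circ; MathComp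
   writes both groups multiplicatively. *)
Definition add_group (T : Type) : Type := T.
Definition circ_group (T : Type) : Type := T.

HB.instance Definition _ (B : choiceType) := Choice.copy (add_group B) B.
HB.instance Definition _ (B : skewBraceType) :=
  isGroup.Build (add_group B)
    (@baddA B) (@badd0l B) (@badd0r B) (@baddNl B) (@baddNr B).
HB.instance Definition _ (B : finSkewBraceType) :=
  Finite.copy (add_group B) B.

HB.instance Definition _ (B : choiceType) := Choice.copy (circ_group B) B.
HB.instance Definition _ (B : skewBraceType) :=
  isGroup.Build (circ_group B)
    (@circA B) (@circ1l B) (@circ1r B) (@circVl B) (@circVr B).
HB.instance Definition _ (B : finSkewBraceType) :=
  Finite.copy (circ_group B) B.

Definition lam (B : skewBraceType) (a b : B) : B := - a + a ** b.

(* Closure under circ and binv is derived below (ideal_circ, ideal_inv). *)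
Record is_ideal (B : skewBraceType) (I : set B) : Prop := IsIdeal {
  ideal0 : I 0;
  idealD : forall x y, I x -> I y -> I (x + y);
  idealN : forall x, I x -> I (- x);
  ideal_add_normal : forall b x, I x -> I (b + x - b);
  ideal_lam : forall b x, I x -> I (lam b x);
  ideal_circ_normal : forall b x, I x -> I (b ** x ** binv b)
}.

Record ideal (B : skewBraceType) := Ideal {
  ideal_set :> set B;
  idealP : is_ideal ideal_set
}.

Definition Soc (B : skewBraceType) : set B :=
  [set a | (forall b, lam a b = b) /\ (forall b, a + b = b + a)].
Arguments Soc B _ : clear implicits.

Section SkewBraceTheory.
Variable B : skewBraceType.
Implicit Types a b c x y : B.

Lemma baddK a b : - a + (a + b) = b.
Proof. by rewrite baddA baddNl badd0l. Qed.

Lemma baddNK a b : a + (- a + b) = b.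
Proof. by rewrite baddA baddNr badd0l. Qed.

Lemma baddI a b c : a + b = a + c -> b = c.
Proof. by move=> /(congr1 (badd (- a))); rewrite !baddK. Qed.

Lemma boppK a : - - a = a.
Proof. by apply: (@baddI (- a)); rewrite baddNl baddNr. Qed.

Lemma boppD a b : - (a + b) = - b - a.
Proof. by apply: (@baddI (a + b)); rewrite baddNr -baddA baddNK baddNr. Qed.

Lemma circ0r a : a ** 0 = a.
Proof.
have := circDr a 0 0; rewrite badd0l -baddA -{1}[a ** 0]badd0r => /baddI /esym E.
by apply: (@baddI (- a)); rewrite E baddNl.
Qed.

Lemma bone0 : bone = 0 :> B.
Proof. by rewrite -[LHS]circ0r circ1l. Qed.

Lemma circE a b : a ** b = a + lam a b.
Proof. by rewrite /lam baddNK. Qed.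

Lemma lamM a b c : lam (a ** b) c = lam a (lam b c).
Proof.
apply: (@baddI (a ** b)); rewrite -circE -circA (circE b) circDr -!baddA.
by congr (_ + _).
Qed.

Lemma lam0 c : lam 0 c = c.
Proof. by apply: (@baddI 0); rewrite -circE -bone0 circ1l bone0 badd0l. Qed.

Lemma lamK a c : lam (binv a) (lam a c) = c.
Proof. by rewrite -lamM circVl bone0 lam0. Qed.

End SkewBraceTheory.

Section Quotient.
Variables (B : skewBraceType) (I : ideal B).
Implicit Types x y z : B.

Definition ideal_rel : rel B := fun x y => `[< ideal_set I (- x + y) >].

Fact ideal_relxx : reflexive ideal_rel.
Proof. by move=> x; apply/asboolP; rewrite baddNl; apply: ideal0 (idealP I). Qed.

Fact ideal_rel_sym : symmetric ideal_rel.
Proof.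
have sub x y : ideal_rel x y -> ideal_rel y x.
  move=> /asboolP /(idealN (idealP I)).
  by rewrite boppD boppK => ?; apply/asboolP.
by move=> x y; apply/idP/idP; apply: sub.
Qed.

Fact ideal_rel_trans : transitive ideal_rel.
Proof.
move=> y x z /asboolP xy /asboolP yz; apply/asboolP.
by have := idealD (idealP I) xy yz; rewrite -baddA baddNK.
Qed.

Canonical ideal_equiv := EquivRel ideal_rel ideal_relxx ideal_rel_sym
  ideal_rel_trans.

Definition quo : Type := {eq_quot ideal_equiv}%qT.
HB.instance Definition _ := EqQuotient.on quo.
HB.instance Definition _ := Choice.on quo.

Definition proj : B -> quo := \pi_quo%qT.

Lemma proj_eq x y : proj x = proj y <-> ideal_set I (- x + y).
Proof. by split=> [/eqquotP/asboolP|?]; last exact/eqquotP/asboolP. Qed.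

Lemma proj_repr (u : quo) : proj (repr u) = u.
Proof. exact: reprK. Qed.

Lemma ideal_circP x y : ideal_set I (- x + y) <-> ideal_set I (binv x ** y).
Proof.
have e : - x + y = lam x (binv x ** y).
  by rewrite /lam circA circVr circ1l.
split=> [|h]; last by rewrite e; apply: ideal_lam (idealP I) _ _ h.
by rewrite e => /(ideal_lam (idealP I) (binv x)); rewrite lamK.
Qed.

Lemma ideal_circ x y : ideal_set I x -> ideal_set I y -> ideal_set I (x ** y).
Proof.
by rewrite circE => Ix Iy; apply: idealD (idealP I) _ _ Ix (ideal_lam (idealP I) _ Iy).
Qed.

Lemma ideal_inv x : ideal_set I x -> ideal_set I (binv x).
Proof.
move=> Ix; have := proj1 (ideal_circP x 0).
by rewrite badd0r circ0r; apply; apply: idealN (idealP I) _ Ix.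
Qed.

Lemma binvM x y : binv (x ** y) = binv y ** binv x.
Proof.
rewrite -[RHS]circ1r -(circVr (x ** y)) !circA -(circA (binv y)) circVl circ1r.
by rewrite circVl circ1l.
Qed.

Lemma binvK x : binv (binv x) = x.
Proof. by rewrite -[LHS]circ1r -(circVl x) circA circVl circ1l. Qed.

Definition quo_add (u v : quo) : quo := proj (repr u + repr v).
Definition quo_opp (u : quo) : quo := proj (- repr u).
Definition quo_circ (u v : quo) : quo := proj (repr u ** repr v).
Definition quo_inv (u : quo) : quo := proj (binv (repr u)).

Lemma quo_addE x y : quo_add (proj x) (proj y) = proj (x + y).
Proof.
apply/proj_eq; set x' := repr _; set y' := repr _.
have /proj_eq hx : proj x' = proj x by rewrite proj_repr.
have /proj_eq hy : proj y' = proj y by rewrite proj_repr.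
have := idealD (idealP I) (ideal_add_normal (idealP I) (- y') hx) hy.
by rewrite boppD boppK -!baddA baddNK.
Qed.

Lemma quo_oppE x : quo_opp (proj x) = proj (- x).
Proof.
apply/proj_eq; set x' := repr _.
have /proj_eq hx : proj x = proj x' by rewrite proj_repr.
by have := ideal_add_normal (idealP I) x' hx; rewrite boppK -!baddA baddNr badd0r.
Qed.

Lemma quo_circE x y : quo_circ (proj x) (proj y) = proj (x ** y).
Proof.
apply/proj_eq/ideal_circP; set x' := repr _; set y' := repr _.
have /proj_eq/ideal_circP hx : proj x' = proj x by rewrite proj_repr.
have /proj_eq/ideal_circP hy : proj y' = proj y by rewrite proj_repr.
have := ideal_circ (ideal_circ_normal (idealP I) (binv y') hx) hy.
by rewrite binvM binvK -!circA (circA y') circVr circ1l.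
Qed.

Lemma quo_invE x : quo_inv (proj x) = proj (binv x).
Proof.
apply/proj_eq/ideal_circP; set x' := repr _.
have /proj_eq/ideal_circP hx : proj x = proj x' by rewrite proj_repr.
have := ideal_circ_normal (idealP I) x' hx.
by rewrite binvK -!circA circVr circ1r.
Qed.

Let quoE := (quo_addE, quo_oppE, quo_circE, quo_invE).

Lemma quo_ind (P : quo -> Prop) : (forall x, P (proj x)) -> forall u, P u.
Proof. by move=> h u; rewrite -[u]proj_repr. Qed.

Fact quo_addA : associative quo_add.
Proof. by do 3![elim/quo_ind=> ?]; rewrite !quoE baddA. Qed.
Fact quo_add0 : left_id (proj 0) quo_add.
Proof. by elim/quo_ind=> ?; rewrite !quoE badd0l. Qed.
Fact quo_addr0 : right_id (proj 0) quo_add.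
Proof. by elim/quo_ind=> ?; rewrite !quoE badd0r. Qed.
Fact quo_addN : left_inverse (proj 0) quo_opp quo_add.
Proof. by elim/quo_ind=> ?; rewrite !quoE baddNl. Qed.
Fact quo_addrN : right_inverse (proj 0) quo_opp quo_add.
Proof. by elim/quo_ind=> ?; rewrite !quoE baddNr. Qed.
Fact quo_circA : associative quo_circ.
Proof. by do 3![elim/quo_ind=> ?]; rewrite !quoE circA. Qed.
Fact quo_circ1 : left_id (proj bone) quo_circ.
Proof. by elim/quo_ind=> ?; rewrite !quoE circ1l. Qed.
Fact quo_circr1 : right_id (proj bone) quo_circ.
Proof. by elim/quo_ind=> ?; rewrite !quoE circ1r. Qed.
Fact quo_circV : left_inverse (proj bone) quo_inv quo_circ.
Proof. by elim/quo_ind=> ?; rewrite !quoE circVl. Qed.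
Fact quo_circrV : right_inverse (proj bone) quo_inv quo_circ.
Proof. by elim/quo_ind=> ?; rewrite !quoE circVr. Qed.
Fact quo_circDr u v w :
  quo_circ u (quo_add v w)
  = quo_add (quo_add (quo_circ u v) (quo_opp u)) (quo_circ u w).
Proof.
by move: u v w; do 3![elim/quo_ind=> ?]; rewrite !quoE circDr.
Qed.

HB.instance Definition _ := Choice_isSkewBrace.Build quo
  quo_addA quo_add0 quo_addr0 quo_addN quo_addrN
  quo_circA quo_circ1 quo_circr1 quo_circV quo_circrV quo_circDr.

End Quotient.

Definition has_prime_order (T : Type) (A : set T) : Prop :=
  exists2 p : nat, prime p & (A #= `I_p)%card.

Definition infinite_cyclic (G : groupType) (A : set G) : Prop :=
  infinite_set A /\
  exists g : G, A = [set x | exists n : nat, x = (g ^+ n)%g \/ x = (g ^- n)%g].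

(* The subset J / I of the quotient skew brace B / I. *)
Definition factor (B : skewBraceType) (I J : ideal B) : set (quo I) :=
  @proj B I @` J.
Arguments factor {B} I J _.

Definition supersoluble (B : skewBraceType) : Prop :=
  exists (n : nat) (I : nat -> ideal B),
    [/\ I 0%N = [set 0] :> set B,
        I n = [set: B] :> set B,
        forall i, (i < n)%N -> I i `<=` I i.+1
      & forall i, (i < n)%N ->
          (factor (I i) (I i.+1) `<=` Soc (quo (I i)) /\
           @infinite_cyclic (add_group (quo (I i))) (factor (I i) (I i.+1)))
          \/ has_prime_order (factor (I i) (I i.+1))].

(* Main.v *)
From mathcomp Require Import classical_sets cardinality.
From mathcomp Require Import all_boot all_fingroup all_solvable.
Require Import Defs.

(** In both cases every proper ideal [I] is contained in an ideal [J] with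
    [#|J : I|] prime; iterating this from the zero ideal yields the required
    series ([supersoluble_of_prime_steps]).

    If [circ] is cyclic, with generator [g], consider inside [Sym(B)] the group
    [H] of the affine maps [y |-> b + lam c y], that is, the translations of
    (B,+) extended by [lam(B)].  Since [a ** y = a + lam a y], every affine map
    is a composite of some [a ** _] and some [lam c], so [H] is the product of
    the cyclic group generated by [lam g] and the cyclic group generated by
    [g ** _] ([holo_mul_cyclic]).  A finite group that is a product of two
    cyclic groups is supersoluble: the larger factor meets its conjugate by a generator
    of the smaller one nontrivially, and the intersection is normal
    ([mul_cyclic_prime_normal_le]).  Hence any two nested normal subgroups of
    [H] can be refined by one of prime index over the smaller
    ([mul_cyclic_section_prime]).  Because [circ] is abelian, the ideals of [B]
    are exactly the sets of translation vectors of normal subgroups of [H]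
    consisting of translations ([translations_normal], [translated_ideal]).

    If + is cyclic, with generator [g], all subgroups of (B,+) are normal and
    invariant under [lam]; only normality in (B,circ) is at stake.  Let [K] be
    the set of the [a] for which [lam a] is the identity modulo [I].  If [K]
    were equal to [I], then sending the class of [a] to the class of [lam a g]
    would be an injective self-map of the finite set B/I; but it never hits 0
    when [I] is proper ([acts_trivially_nontrivial]).  So [K/I] is nontrivial.
    On [K] the two operations agree modulo [I], so for a prime [p] dividing the
    order of [K/I] the subgroup [J/I] of order [p] in the cyclic group (B/I,+)
    is the set of elements [x] of [K/I] with [x ** ... ** x = 0] ([p] factors),
    a condition stable under conjugation in (B,circ). *)

Set Implicit Arguments.
Unset Strict Implicit.
Unset Printing Implicit Defensive.

Local Open Scope group_scope.

(** * Products of two cyclic groups *)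

Lemma cyclic_prime_normal (gT : finGroupType) (G D : {group gT}) :
  cyclic D -> D <| G -> D :!=: 1 ->
  exists2 M : {group gT}, M <| G & prime #|M|.
Proof.
move=> cycD nDG ntD; have [p p_pr pD] : {p | prime p & p %| #|D|}.
  by exists (pdiv #|D|); rewrite ?pdiv_prime ?pdiv_dvd // cardG_gt1.
have [x Dx ox] := Cauchy p_pr pD.
exists <[x]>%G; last by rewrite [#|_|]ox.
apply: char_normal_trans nDG.
by rewrite sub_cyclic_char // cycle_subG.
Qed.

(** Let [b] generate [B].  A subgroup of the cyclic group [A] is determined by
    its order, so [A :&: A :^ b] is normalised by [b], and hence normal in
    [A * B].  If it were trivial, [A * A :^ b] would have [#|A| ^ 2 >= #|G|]
    elements, hence be [G]; but a group is never the product of two conjugates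
    of a proper subgroup. *)
Lemma mul_cyclic_prime_normal_le (gT : finGroupType) (G A B : {group gT}) :
    cyclic A -> cyclic B -> A * B = G -> #|B| <= #|A| -> G :!=: 1 ->
  exists2 M : {group gT}, M <| G & prime #|M|.
Proof.
move=> cycA /cyclicP[b defB] defG leBA ntG.
have sAG : A \subset G by rewrite -defG mulG_subl.
have Gb : b \in G.
  by rewrite -defG -[b]mul1g mem_mulg ?group1 // defB cycle_id.
have [tiA | ntD] := eqVneq (A :&: A :^ b) 1.
  have defGA : A * A :^ b = G.
    apply/eqP; rewrite eqEcard mul_subG ?conj_subG //=.
    rewrite TI_cardMg // cardJg -defG.
    apply: leq_trans (leq_mul (leqnn _) leBA).
    by rewrite mul_cardG leq_pmulr ?cardG_gt0.
  have Ab : b \in A.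
    move: Gb; rewrite -{1}defGA => /mulsgP[a1 _ Aa1 /imsetP[a2 Aa2 ->] eq_b].
    have <- : a2 * a1 = b.
      have E1 : a1 * (b^-1 * a2) = 1.
        by apply: (mulIg b); rewrite mul1g [RHS]eq_b conjgE !mulgA.
      move/eqP: E1; rewrite -eq_invg_mul => /eqP E1.
      by apply: (mulgI b^-1); rewrite mulgA -E1 !mulVg.
    by rewrite groupM.
  have A1 : A :=: 1 by rewrite -tiA conjGid // setIid.
  move: leBA ntG; rewrite -defG A1 mul1g cards1 -trivg_card_le1.
  by move=> ->.
apply: (@cyclic_prime_normal _ G (A :&: A :^ b)%G) => //.
  by apply: cyclicS cycA; rewrite subsetIl.
apply/andP; split; first by apply: subset_trans sAG; rewrite subsetIl.
rewrite -defG mul_subG //.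
  by rewrite cents_norm // (sub_abelian_cent2 (cyclic_abelian cycA)) ?subsetIl.
rewrite defB cycle_subG -groupV inE.
have -> : (A :&: A :^ b) :^ b^-1 = A :&: A :^ b; last by [].
apply/eqP; rewrite (eq_subG_cyclic cycA) ?subsetIl ?cardJg //.
by rewrite /= conjIg conjsgK subsetIr.
Qed.

Lemma mul_cyclic_prime_normal (gT : finGroupType) (G A B : {group gT}) :
    cyclic A -> cyclic B -> A * B = G -> G :!=: 1 ->
  exists2 M : {group gT}, M <| G & prime #|M|.
Proof.
move=> cycA cycB defG; case: (leqP #|B| #|A|) => [|/ltnW].
  exact: mul_cyclic_prime_normal_le.
apply: mul_cyclic_prime_normal_le => //.
by rewrite -(comm_group_setP _) ?defG ?groupP.
Qed.

(** Let [M] be a normal subgroup of [G] of prime order.  If [M] is not contained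
    in [N], then [N] embeds in [G / M], itself a product of two cyclic groups,
    and a subgroup found there pulls back to [N]. *)
Lemma mul_cyclic_sub_normal (gT : finGroupType) (G A B N : {group gT}) :
    cyclic A -> cyclic B -> A * B = G -> N <| G -> N :!=: 1 ->
  exists M : {group gT}, [/\ M <| G, M \subset N & prime #|M|].
Proof.
have [n] := ubnP #|G|; elim: n => // n IHn in gT G A B N *.
rewrite ltnS => leGn cycA cycB defG nNG ntN.
have ntG : G :!=: 1.
  by apply: contra_neq ntN => G1; apply/trivgP; rewrite -G1 normal_sub.
have [M nMG pM] := mul_cyclic_prime_normal cycA cycB defG ntG.
have [sMN | nsMN] := boolP (M \subset N); first by exists M.
have tiMN : M :&: N = 1 by apply: prime_TIg.
have nNM : N \subset 'N(M).
  exact: subset_trans (normal_sub nNG) (normal_norm nMG).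
have nAM : A \subset 'N(M).
  by apply: subset_trans (normal_norm nMG); rewrite -defG mulG_subl.
have defGM : (A / M) * (B / M) = G / M by rewrite -quotientMl ?defG.
have ntNM : N / M != 1.
  rewrite -subG1 quotient_sub1 //; apply: contra ntN => sNM.
  by rewrite -subG1 -tiMN subsetI sNM subxx.
have [||||P [nPG sPN pP]] :=
  IHn _ (G / M)%G (A / M)%G (B / M)%G (N / M)%G _ _ _ defGM _ ntNM.
- apply: leq_trans leGn; apply: ltn_quotient; last exact: normal_sub.
  by rewrite -cardG_gt1 prime_gt1.
- exact: quotient_cyclic.
- exact: quotient_cyclic.
- exact: quotient_normal.
have sKN : N :&: coset M @*^-1 P \subset N := subsetIl _ _.
exists (N :&: coset M @*^-1 P)%G; split=> //.
  by rewrite normalI // -(quotientGK nMG) cosetpre_normal.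
have isoP : N :&: coset M @*^-1 P \isog P.
  rewrite -[X in _ \isog X](setIidPr sPN) -quotient_setIpre.
  rewrite quotient_isog ?(subset_trans sKN) //.
  by apply/trivgP; rewrite -tiMN setIS.
by rewrite (card_isog isoP).
Qed.

Lemma mul_cyclic_section_prime (gT : finGroupType) (G A B I N : {group gT}) :
    cyclic A -> cyclic B -> A * B = G -> I <| G -> N <| G -> I \proper N ->
  exists J : {group gT},
    [/\ J <| G, I \subset J, J \subset N & prime #|J : I|].
Proof.
move=> cycA cycB defG nIG nNG /andP[sIN nsNI].
have nIA : A \subset 'N(I).
  by rewrite (subset_trans _ (normal_norm nIG)) // -defG mulG_subl.
have defGI : (A / I) * (B / I) = G / I by rewrite -quotientMl ?defG.
have nNI : I <| N := normalS sIN (normal_sub nNG) nIG.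
have ntNI : N / I != 1 by rewrite -subG1 quotient_sub1 ?normal_norm.
have [||M [nMG sMN pM]] :=
  mul_cyclic_sub_normal _ _ defGI (quotient_normal I nNG) ntNI.
- exact: quotient_cyclic.
- exact: quotient_cyclic.
exists (coset I @*^-1 M)%G; split.
- by rewrite -(quotientGK nIG) cosetpre_normal.
- exact: normal_sub (normal_cosetpre M).
- by rewrite -(quotientGK nNI) cosetpreSK.
- by rewrite -card_quotient ?cosetpreK // normal_norm ?normal_cosetpre.
Qed.

(** * The maps lam *)

Section Lam.
Variable B : skewBraceType.
Implicit Types a b c x y : B.

Lemma lamD a x y : lam a (badd x y) = badd (lam a x) (lam a y).
Proof. by rewrite /lam circDr !baddA. Qed.

Lemma lamr0 a : lam a bzero = bzero.
Proof. by rewrite /lam circ0r baddNl. Qed.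

Lemma lam_addX a x k :
  lam a ((x : add_group B) ^+ k) = (lam a x : add_group B) ^+ k.
Proof.
elim: k => [|k IHk]; first by rewrite !expg0 [lam a _]lamr0.
by rewrite !expgS -IHk [lam a _]lamD.
Qed.

Lemma lamVK a x : lam a (lam (binv a) x) = x.
Proof. by rewrite -lamM circVr bone0 lam0. Qed.

Lemma lam_inj a : injective (lam a).
Proof. exact: can_inj (lamK a). Qed.

End Lam.

(** * Ideals as subgroups, and series with prime factors *)

Definition ideal_group (B : finSkewBraceType) (I : {group add_group B}) : Prop :=
  is_ideal (B := B) (fun x => x \in I).

Lemma ideal_group_normal (B : finSkewBraceType) (I : {group add_group B}) :
  ideal_group I -> I <| [set: add_group B].
Proof.
move=> idI; apply/andP; split; first exact: subsetT.
apply/subsetP=> b _; rewrite -groupV inE; apply/subsetP=> _ /imsetP[x Ix ->].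
by rewrite conjgE invgK mulgA; apply: (ideal_add_normal idI b Ix).
Qed.

Lemma card_eq_set (T : finType) (A : {set T}) : ([set` A] #= `I_#|A|)%card.
Proof.
rewrite card_eq_sym; apply: (card_eq_trans card_II).
suff -> : [set` A]%classic = [set enum_val i | i in [set: 'I_#|A|]]%classic.
  by rewrite card_eq_sym; apply: inj_card_eq => i j _ _; apply: enum_val_inj.
apply/seteqP; split=> [x Ax | _ [i _ <-]]; last exact: enum_valP.
by exists (enum_rank_in Ax x); rewrite ?enum_rankK_in.
Qed.

(** The quotient skew brace by [I] and the quotient group of (B,+) by [I] are
    built differently; choosing coset representatives identifies them. *)
Lemma has_prime_order_factor (B : finSkewBraceType)
    (I J : {group add_group B}) (idI : ideal_group I) (idJ : ideal_group J) :
  I \subset J -> prime #|J : I| ->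
  has_prime_order (factor (Ideal idI) (Ideal idJ)).
Proof.
move=> sIJ pr_JI; exists #|J : I| => //.
have nI := normal_norm (ideal_group_normal idI).
have nIx (x : add_group B) : x \in 'N(I) by rewrite (subsetP nI) ?inE.
have nIJ : J \subset 'N(I) := subset_trans (subsetT _) nI.
have projE (x y : B) :
    (proj (Ideal idI) x = proj (Ideal idI) y) <-> (coset I x = coset I y).
  split=> [/proj_eq /= Ixy | eq_xy].
    apply: (mulgI (coset I x)^-1); rewrite mulVg -morphV // -morphM //.
    by rewrite [RHS]coset_id.
  apply/proj_eq => /=; rewrite -[_ \in _]/((x : add_group B)^-1 * y \in I).
  apply: coset_idr; first by rewrite groupM ?groupV.
  by rewrite morphM ?groupV // morphV //= eq_xy mulVg.
pose h (u : coset_of I) := proj (Ideal idI) (repr u).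
have hE (x : add_group B) : h (coset I x) = proj (Ideal idI) x.
  by apply/projE; rewrite coset_reprK.
have -> : factor (Ideal idI) (Ideal idJ) = [set h u | u in [set` J / I]]%classic.
  apply/seteqP; split=> [_ [x Jx <-] | _ [u /= /morphimP[x _ Jx ->] <-]].
    by exists (coset I x); rewrite /= ?mem_quotient.
  by rewrite hE; exists x.
apply: card_eq_trans.
  apply: inj_card_eq => _ _ /set_mem/morphimP[x _ _ ->]
    /set_mem/morphimP[y _ _ ->].
  by rewrite !hE => /projE.
by rewrite -card_quotient //; apply: card_eq_set.
Qed.

Lemma supersoluble_of_prime_steps (B : finSkewBraceType) :
    (forall I : {group add_group B},
       ideal_group I -> I \proper [set: add_group B] ->
     exists J : {group add_group B},
       [/\ ideal_group J, I \subset J & prime #|J : I|]) ->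
  supersoluble B.
Proof.
move=> step.
suff chain (I : {group add_group B}) (idI : ideal_group I) :
    exists n (F : nat -> ideal B),
    [/\ F 0%N = Ideal idI, F n = [set: B]%classic :> set B,
        forall i, i < n -> (F i `<=` F i.+1)%classic
      & forall i, i < n -> has_prime_order (factor (F i) (F i.+1))].
  have id1 : ideal_group [1 add_group B]%G.
    split=> [|x y /set1P-> /set1P->|x /set1P->|b x /set1P->
            |b x /set1P->|b x /set1P->].
    - exact: group1.
    - by rewrite [badd _ _]badd0l; apply: group1.
    - by apply: (@groupVr (add_group B)); apply: group1.
    - by rewrite [badd b _]badd0r baddNr; apply: group1.
    - by rewrite [lam b _]lamr0; apply: group1.
    - by rewrite [circ b _]circ0r circVr bone0; apply: group1.
  have [n [F [F0 Fn sF pF]]] := chain _ id1.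
  exists n, F; split=> // [|i /pF]; last by right.
  by rewrite F0; apply/seteqP; split=> x /= /set1P.
have [m] := ubnP (#|[set: add_group B]| - #|I|).
elim: m I idI => // m IHm I idI; rewrite ltnS => le_m.
have [topI | nTI] := boolP ([set: add_group B] \subset I).
  exists 0%N, (fun=> Ideal idI); split=> //.
  by apply/seteqP; split=> // x _ /=; apply: (subsetP topI).
have prI : I \proper [set: add_group B] by rewrite properE subsetT.
have [J [idJ sIJ prJI]] := step I idI prI.
have [|n [F [F0 Fn sF pF]]] := IHm J idJ.
  apply: leq_trans le_m; rewrite ltn_sub2l ?proper_card //.
  rewrite properEcard sIJ -(Lagrange sIJ) -{1}[#|I|]muln1 ltn_pmul2l //.
  exact: prime_gt1.
exists n.+1, (fun i => if i is k.+1 then F k else Ideal idI).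
split=> //; case=> [_|i]; [|exact: sF| |exact: pF]; rewrite F0.
  by move=> x /=; apply: (subsetP sIJ).
exact: has_prime_order_factor.
Qed.

(** * Cyclic multiplicative group *)

Section Affine.
Variable B : finSkewBraceType.
Implicit Types a b c x y : B.

Lemma affine_inj b c : injective (fun y : B => badd b (lam c y)).
Proof. by move=> x y /baddI /lam_inj. Qed.

(** In particular [affine b bzero] is a translation of (B,+), [affine bzero c]
    is [lam c], and [affine a a] is [circ a]. *)
Definition affine b c : {perm B} := perm (@affine_inj b c).

Lemma affineM b c b' c' :
  affine b c * affine b' c' = affine (badd b' (lam c' b)) (circ c' c).
Proof. by apply/permP=> y; rewrite permM !permE lamD lamM baddA. Qed.

Lemma affine1 : affine bzero bzero = 1.
Proof. by apply/permP=> y; rewrite permE perm1 lam0 badd0l. Qed.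

Lemma affine_trans_inj : injective (fun b => affine b bzero).
Proof. by move=> x y /permP/(_ bzero); rewrite !permE lam0 !badd0r. Qed.

(** This is the semidirect product of (B,+) by the image of [lam], acting
    on [B]. *)
Definition holo : {set {perm B}} := [set affine p.1 p.2 | p : B * B].

Lemma holoP s : reflect (exists b c, s = affine b c) (s \in holo).
Proof.
apply: (iffP imsetP) => [[[b c] _ ->] | [b [c ->]]]; first by exists b, c.
by exists (b, c).
Qed.

Lemma affine_holo b c : affine b c \in holo.
Proof. by apply/holoP; exists b, c. Qed.

Lemma holo_group_set : group_set holo.
Proof.
apply/group_setP; split=> [|_ _ /holoP[b [c ->]] /holoP[b' [c' ->]]].
  by rewrite -affine1 affine_holo.
by rewrite affineM affine_holo.
Qed.
Canonical holo_group := Group holo_group_set.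

Definition translations (I : {set B}) : {set {perm B}} :=
  [set affine b bzero | b in I].

Lemma mem_translations I b : (affine b bzero \in translations I) = (b \in I).
Proof. exact: mem_imset affine_trans_inj. Qed.

Lemma affine_transM x y :
  affine x bzero * affine y bzero = affine (badd y x) bzero.
Proof. by rewrite affineM lam0 circ0r. Qed.

Lemma translations_group_set (I : {group add_group B}) :
  group_set (translations I).
Proof.
apply/group_setP; split=> [|_ _ /imsetP[x Ix ->] /imsetP[y Iy ->]].
  by rewrite -affine1 mem_translations; apply: (group1 I).
by rewrite affine_transM mem_translations; apply: (groupM (G := I)).
Qed.
Canonical translations_group I := Group (translations_group_set I).

(** Conjugation by affine maps acts on translation vectors through [lam] and
    through additive conjugation: normality in [holo] thus matches invariance
    under [lam] together with normality in (B,+). *)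
Lemma affine_transJ b c x :
  affine x bzero ^ affine b c
  = affine (badd (badd b (lam c x)) (bopp b)) bzero.
Proof.
apply: (mulgI (affine b c)); rewrite -conjgC !affineM lam0 circ0r.
rewrite -[circ _ c]/(circ bzero c) -{1}bone0 circ1l.
by rewrite -!baddA baddNl badd0r.
Qed.

Lemma translations_normal (I : {group add_group B}) :
  ideal_group I -> translations_group I <| holo_group.
Proof.
move=> idI; apply/andP; split.
  by apply/subsetP=> _ /imsetP[x _ ->]; apply: affine_holo.
apply/subsetP=> _ /holoP[b [c ->]]; rewrite inE.
apply/subsetP=> _ /imsetP[_ /imsetP[x Ix ->] ->].
rewrite affine_transJ mem_translations.
by apply: (ideal_add_normal idI); apply: (ideal_lam idI).
Qed.

Definition translated (J : {group {perm B}}) : {set B} :=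
  [set b | affine b bzero \in J].

Lemma translated_group_set (J : {group {perm B}}) :
  group_set (translated J : {set add_group B}).
Proof.
apply/group_setP; split=> [|x y]; rewrite !inE.
  by rewrite [affine _ _]affine1.
by move=> Jx Jy; rewrite -affine_transM groupM.
Qed.
Canonical translated_group J : {group add_group B} :=
  Group (translated_group_set J).

Lemma translatedK (J : {group {perm B}}) :
  J \subset translations setT -> translations (translated J) = J.
Proof.
move=> sJT; apply/setP=> s; apply/imsetP/idP => [[x + ->] | Js].
  by rewrite inE.
have /imsetP[x _ def_s] := subsetP sJT s Js.
by exists x; rewrite // inE -def_s.
Qed.

Lemma translated_ideal (J : {group {perm B}}) :
    (forall x y, circ x y = circ y x) -> J <| holo_group ->
  ideal_group (translated_group J).
Proof.
move=> circC nJH.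
have JJ b c x : affine x bzero \in J ->
    affine (badd (badd b (lam c x)) (bopp b)) bzero \in J.
  move=> Jx; rewrite -affine_transJ memJ_norm //.
  by rewrite (subsetP (normal_norm nJH)) ?affine_holo.
split=> [|x y Jx Jy|x Jx|b x|b x|b x].
- exact: (group1 (translated_group J)).
- exact: (groupM (G := translated_group J)).
- exact: (groupVr (G := translated_group J)).
- by rewrite !inE => /(JJ b bzero); rewrite lam0.
- rewrite !inE => /(JJ bzero b).
  by rewrite badd0l -[bopp _]badd0l baddNr badd0r.
- by rewrite circC circA circVl circ1l.
Qed.

(** Solving [circ a (lam c y) = badd b (lam c' y)] gives [a = b] and
    [c = circ (binv b) c'], so every affine map is some [lam c] followed by some
    [circ a]. *)
Lemma holo_mul_cyclic g : [set: circ_group B] = <[g : circ_group B]> ->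
  <[affine bzero g]> * <[affine g g]> = holo.
Proof.
move=> defB.
have powE (F : B -> {perm B}) : F bzero = 1 ->
    (forall x y, F x * F y = F (circ y x)) ->
    forall k, F g ^+ k = F ((g : circ_group B) ^+ k).
  move=> F0 FM; elim=> [|k IHk]; first by rewrite expg0 -F0 -bone0.
  by rewrite expgS IHk FM (@expgSr (circ_group B)).
have lamE := powE (affine bzero).
have circE' := powE (fun a => affine a a).
apply/eqP; rewrite eqEsubset mul_subG ?cycle_subG ?affine_holo //=.
apply/subsetP=> _ /holoP[b [c ->]].
have gen (x : B) : exists k, x = (g : circ_group B) ^+ k.
  have /cycleP[k ->] : (x : circ_group B) \in <[g : circ_group B]>.
    by rewrite -defB inE.
  by exists k.
have -> : affine b c = affine bzero (circ (binv b) c) * affine b b.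
  by rewrite affineM circA circVr circ1l lamr0 badd0r.
have [[i ->] [j ->]] := (gen (circ (binv b) c), gen b).
rewrite -lamE ?affine1 // => [|x y]; last by rewrite affineM lamr0 badd0r.
rewrite -circE' ?affine1 // => [|x y]; last by rewrite affineM -circE.
by rewrite mem_mulg ?mem_cycle.
Qed.

Lemma prime_step_circ_cyclic (I : {group add_group B}) :
    cyclic [set: circ_group B] -> ideal_group I ->
    I \proper [set: add_group B] ->
  exists J : {group add_group B},
    [/\ ideal_group J, I \subset J & prime #|J : I|].
Proof.
move=> cycB idI /properP[_ [x _ nIx]].
have circC (a b : B) : circ a b = circ b a.
  by apply: (centsP (cyclic_abelian cycB)); rewrite inE.
have /cyclicP[g defB] := cycB.
have idT : ideal_group [set: add_group B]%G by split=> *; apply: in_setT.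
have [] := mul_cyclic_section_prime (G := holo_group)
  (cycle_cyclic (affine bzero g)) (cycle_cyclic (affine g g))
  (holo_mul_cyclic defB) (translations_normal idI) (translations_normal idT).
  apply/properP; split; first by rewrite imsetS ?subsetT.
  by exists (affine x bzero); rewrite mem_translations ?inE.
move=> J [nJ sIJ sJT prJ]; exists (translated_group J).
have sIJ' : I \subset translated_group J.
  by apply/subsetP=> y Iy; rewrite inE (subsetP sIJ) ?mem_translations.
split=> //; first exact: translated_ideal.
have cardT (A : {set B}) : #|translations A| = #|A|.
  by rewrite card_imset //; apply: affine_trans_inj.
rewrite -divgS //= -!cardT translatedK //.
by move: prJ; rewrite -divgS.
Qed.

End Affine.

(** * Cyclic additive group *)

Section AddCyclic.
Variables (B : finSkewBraceType) (g : B) (I : {group add_group B}).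
Hypothesis defB : [set: add_group B] = <[g : add_group B]>.
Hypothesis idI : ideal_group I.
Implicit Types a b c x y : B.

Let q (x : B) : coset_of I := coset I (x : add_group B).

Let mem_gen x : (x : add_group B) \in <[g : add_group B]>.
Proof. by rewrite -defB inE. Qed.

Lemma norm_ideal x : (x : add_group B) \in 'N(I).
Proof. by rewrite (subsetP (normal_norm (ideal_group_normal idI))) ?inE. Qed.

Lemma qD x y : q (badd x y) = q x * q y.
Proof. exact: morphM (norm_ideal x) (norm_ideal y). Qed.

Lemma qX x k : q ((x : add_group B) ^+ k) = q x ^+ k.
Proof. exact: morphX (norm_ideal x). Qed.

Lemma q_eq1 x : (q x == 1) = (x \in I).
Proof. by apply/eqP/idP => [/(coset_idr (norm_ideal x)) | /coset_id]. Qed.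

Lemma q0 : q bzero = 1.
Proof. by apply/eqP; rewrite q_eq1 (group1 I). Qed.

Lemma q_eqP x y : q x = q y <-> badd (bopp x) y \in I.
Proof.
rewrite -q_eq1 qD.
have -> : q (bopp x) = (q x)^-1 by exact: morphV (norm_ideal x).
by rewrite -eq_mulVg1; split=> /eqP.
Qed.

Lemma q_circP x y : q x = q y <-> circ (binv x) y \in I.
Proof. exact: iff_trans (q_eqP x y) (ideal_circP (Ideal idI) x y). Qed.

Lemma q_lam a x y : q x = q y -> q (lam a x) = q (lam a y).
Proof.
move=> /q_eqP Ixy; apply/q_eqP; have := ideal_lam idI a Ixy.
rewrite lamD; congr (badd _ _ \in I); apply: (@baddI _ (lam a x)).
by rewrite -lamD !baddNr lamr0.
Qed.

(** Testing the generator alone suffices for [lam a] to be the identity modulo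
    [I]: see [acts_triviallyP]. *)
Definition acts_trivially a := q (lam a g) = q g.

Lemma acts_triviallyP a x : acts_trivially a -> q (lam a x) = q x.
Proof.
by move=> Ka; have /cycleP[k ->] := mem_gen x; rewrite lam_addX !qX Ka.
Qed.

Lemma acts_trivially_circ a x : acts_trivially a -> q (circ a x) = q a * q x.
Proof. by move=> Ka; rewrite circE qD acts_triviallyP. Qed.

(** For [a] in [I], write [a ** g = g ** a'] with [a'] in [I], by normality in
    (B,circ); then [lam a g = - a + g + lam g a']. *)
Lemma acts_trivially_ideal a : a \in I -> acts_trivially a.
Proof.
move=> Ia; rewrite /acts_trivially.
have def_ag : circ a g = circ g (circ (binv g) (circ a g)).
  by rewrite circA circVr circ1l.
have Ia' := ideal_circ_normal idI (binv g) Ia.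
rewrite binvK // in Ia'.
rewrite /lam def_ag circE baddA qD.
have /eqP-> : q (lam g (circ (binv g) (circ a g))) == 1.
  by rewrite q_eq1; apply: (ideal_lam idI); rewrite circA.
rewrite mulg1 qD.
have /eqP-> : q (bopp a) == 1 by rewrite q_eq1; apply: (idealN idI).
by rewrite mul1g.
Qed.

Lemma acts_trivially_M a b :
  acts_trivially a -> acts_trivially b -> acts_trivially (circ a b).
Proof. by rewrite /acts_trivially => Ka Kb; rewrite lamM acts_triviallyP. Qed.

Lemma acts_trivially_eq a b : q a = q b -> acts_trivially a -> acts_trivially b.
Proof.
move=> /q_circP/acts_trivially_ideal Kab Ka.
have -> : b = circ a (circ (binv a) b) by rewrite circA circVr circ1l.
exact: acts_trivially_M.
Qed.

Lemma acts_trivially_J a b :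
  acts_trivially a -> acts_trivially (circ (circ b a) (binv b)).
Proof.
move=> Ka; rewrite /acts_trivially !lamM -[in RHS](lamVK b g).
exact/q_lam/acts_triviallyP.
Qed.

Lemma acts_trivially_X a k : acts_trivially a ->
  acts_trivially ((a : circ_group B) ^+ k)
  /\ q ((a : circ_group B) ^+ k) = q a ^+ k.
Proof.
move=> Ka; elim: k => [|k [Kk qk]].
  rewrite !expg0 -[(1 : circ_group B)]/(bone : B) bone0; split; last exact: q0.
  exact/acts_trivially_ideal/(group1 I).
rewrite !expgS -qk; split; first exact: acts_trivially_M.
exact: acts_trivially_circ.
Qed.

(** [psi] misses the zero class, as [lam a g] in [I] would put the generator [g]
    in [I].  Hence it is not injective, and two classes [u], [v] with the same
    image give [binv v ** u], which fixes [g] modulo [I]. *)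
Lemma acts_trivially_nontrivial : I \proper [set: add_group B] ->
  exists2 a, acts_trivially a & a \notin I.
Proof.
move=> /properP[_ [x _ nIx]].
pose rep (u : coset_of I) : B := (repr u : add_group B).
pose psi (u : coset_of I) := q (lam (rep u) g).
have q_rep u : q (rep u) = u := coset_reprK u.
have not1 u : psi u != 1.
  rewrite q_eq1; apply: contra nIx => Iu.
  have Ig : g \in I by rewrite -[g](lamK (rep u)); apply: (ideal_lam idI).
  by apply: subsetP (mem_gen x); rewrite cycle_subG.
have /injectivePn[u [v neq_uv eq_psi]] : ~~ injectiveb psi.
  apply/injectiveP=> inj_psi; have /codomP[u] := injF_onto inj_psi 1.
  by move/eqP; rewrite eq_sym (negPf (not1 u)).
exists (circ (binv (rep v)) (rep u)).
  by rewrite /acts_trivially lamM -[in RHS](lamK (rep v) g); apply: q_lam.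
by apply: contra neq_uv => /q_circP; rewrite !q_rep => ->.
Qed.

Lemma prime_step_add_cyclic : I \proper [set: add_group B] ->
  exists J : {group add_group B},
    [/\ ideal_group J, I \subset J & prime #|J : I|].
Proof.
case/acts_trivially_nontrivial=> c Kc nIc.
have cycB : cyclic [set: add_group B] by apply/cyclicP; exists g.
have nt_c : #[q c] > 1 by rewrite order_gt1 q_eq1.
pose p := pdiv #[q c]; have p_pr : prime p := pdiv_prime nt_c.
(* A circ-power of c acts trivially again, and its class is the corresponding
   additive multiple of the class of c, here of order p. *)
pose d : B := (c : circ_group B) ^+ (#[q c] %/ p).
have [Kd qd] : acts_trivially d /\ q d = q c ^+ (#[q c] %/ p).
  exact: acts_trivially_X.
have ord_d : #[q d] = p.
  rewrite qd orderXdiv ?dvdn_div ?pdiv_dvd //.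
  by rewrite divnA ?pdiv_dvd // mulKn ?order_gt0.
pose J := (coset I @*^-1 <[q d]>)%G.
have inJ x : (x \in J) = (q x \in <[q d]>).
  by apply/morphpreP/idP => [[]|]; last by split; first exact: norm_ideal.
(* B/I being cyclic, J/I is its p-torsion. *)
have memJ x : q x ^+ p = 1 -> x \in J.
  move=> xp1; rewrite inJ -cycle_subG.
  have cycI : cyclic ([set: add_group B] / I) by apply: quotient_cyclic cycB.
  rewrite -(cardSg_cyclic cycI) ?cycle_subG ?mem_quotient ?inE //.
  by rewrite -![#|_|]/(#[_]) ord_d order_dvdn xp1.
have Jp x : x \in J -> q x ^+ p = 1.
  rewrite inJ => /cycleP[i ->].
  by rewrite -expgM mulnC expgM -ord_d expg_order expg1n.
exists J; split.
- split=> [|x y|x|b x Jx|b x Jx|b x Jx].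
  + exact: (group1 J).
  + exact: (groupM (G := J)).
  + exact: (groupVr (G := J)).
  + have -> : badd (badd b x) (bopp b) = x; last by [].
    have cbx : commute (b : add_group B) (x : add_group B).
      by apply: (centsP (cyclic_abelian cycB)); rewrite inE.
    by rewrite [badd b x]cbx -baddA baddNr badd0r.
  + apply: memJ; rewrite -qX -lam_addX -q0 -(lamr0 b).
    by apply: q_lam; rewrite qX Jp ?q0.
  + have Kx : acts_trivially x.
      move: Jx; rewrite inJ => /cycleP[i qx].
      have [Ki qi] := acts_trivially_X i Kd.
      by apply: acts_trivially_eq Ki; rewrite qi.
    (* Both x and its circ-conjugate act trivially, so membership in J can be
       tested on p-th circ-powers, which commute with conjugation. *)
    apply: memJ; have Ky := acts_trivially_J b Kx.
    have [_ <-] := acts_trivially_X p Ky.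
    have [_ qxp] := acts_trivially_X p Kx.
    have -> : (circ (circ b x) (binv b) : circ_group B) ^+ p
              = circ (circ b ((x : circ_group B) ^+ p)) (binv b).
      have := conjXg (x : circ_group B) (binv b : circ_group B) p.
      by rewrite !conjgE !invgK !mulgA => /esym.
    apply/eqP; rewrite q_eq1; apply: (ideal_circ_normal idI).
    by rewrite -q_eq1 qxp Jp.
- exact: normal_sub (normal_cosetpre _).
- rewrite -card_quotient ?cosetpreK; first by rewrite [#|_|]ord_d.
  exact/normal_norm/normal_cosetpre.
Qed.

End AddCyclic.

Theorem theorem4p5 (B : finSkewBraceType) :
  cyclic [set: add_group B] \/ cyclic [set: circ_group B] -> supersoluble B.
Proof.
move=> cycB; apply: supersoluble_of_prime_steps => I idI prI.
case: cycB => [/cyclicP[g defB] | cycB]; last exact: prime_step_circ_cyclic.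
exact: prime_step_add_cyclic defB idI prI.
Qed.
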